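(* Let $G$ be an infinite, locally finite, connected simple graph with a fixed vertex $a$, let $\psi:G\to\mathbb{C}$, and let $M_\psi$ be a bounded multiplication operator on $\hat{\mathcal{L}}$ or on $\hat{\mathcal{L}}_0$. Then (for $M_\psi$ acting on that space): (i) $\sigma_{\rm p}(M_\psi)=\psi(G)$; (ii) $\sigma(M_\psi)=\sigma_{\rm ap}(M_\psi)=\overline{\psi(G)}$.
   Context: A graph is always connected, undirected, simple, with infinitely many vertices, each of finite degree; $G$ also denotes its vertex set, $v\sim w$ means $v$ and $w$ are adjacent, $N_v=\{w\in G: w\sim v\}$, and $d$ is the graph distance. The Lipschitz space is $\hat{\mathcal{L}}=\{f:G\to\mathbb{C} : \sup_{v\sim w}|f(v)-f(w)|<\infty\}$ with norm $\|f\|_{\hat{\mathcal{L}}}^{a}:=|f(a)|+\sup_{v\sim w}|f(v)-f(w)|$. The little Lipschitz space $\hat{\mathcal{L}}_0$, with the same norm, is the set of $f\in\hat{\mathcal{L}}$ with $\lim_{d(a,v)\to\infty}\max_{w\in N_v}|f(v)-f(w)|=0$ (for every $\epsilon>0$ there is $N\in\mathbb{N}$ with $\max_{w\in N_v}|f(v)-f(w)|<\epsilon$ whenever $d(a,v)>N$). Both are complex Banach spaces. $M_\psi f:=\psi f$; ''$M_\psi$ is bounded on $X$'' means $\psi f\in X$ for every $f\in X$ and $M_\psi:X\to X$ is a bounded linear operator. $\sigma(\cdot)$, $\sigma_{\rm p}(\cdot)$, $\sigma_{\rm ap}(\cdot)$ denote the spectrum, the point spectrum (set of eigenvalues) and the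 approximate point spectrum of an operator; $\psi(G)=\{\psi(v):v\in G\}$ and the bar is closure in $\mathbb{C}$. *)

(* Defs.v *)
From HB Require Import structures.
From mathcomp Require Import all_boot all_order all_algebra.
From mathcomp Require Import complex.
From mathcomp Require Import all_classical all_reals all_analysis.

Set Implicit Arguments.
Unset Strict Implicit.
Unset Printing Implicit Defensive.

Import Order.TTheory GRing.Theory Num.Theory.
Import numFieldNormedType.Exports.

Local Open Scope classical_set_scope.
Local Open Scope ring_scope.
Local Open Scope complex_scope.

HB.instance Definition _ (R : realType) := NormedModule.copy R[i] (R[i])^o.

(* The suprema below are taken in R, whereas the norm of a normed space
   over R[i] takes its values in R[i]; Normc.normc is the real-valued modulus,
   and `|z| = (Normc.normc z)%:C holds definitionally. *)

Record graph := Graph {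
  vertex :> choiceType;
  adj : rel vertex;
  adj_irrefl : irreflexive adj;
  adj_sym : symmetric adj;
  adj_connected : forall v w, exists2 p, path adj v p & last v p = w;
  adj_finite : forall v, finite_set [set w | adj v w];
  vertex_infinite : infinite_set [set: vertex] }.

Arguments adj {g}.

Section distance.
Variable G : graph.

Definition walk_length (v w : G) : pred nat := fun n =>
  `[< exists p, [/\ path adj v p, last v p = w & size p = n] >].

Lemma walk_length_ex (v w : G) : exists n, walk_length v w n.
Proof.
by have [p vp pw] := adj_connected v w; exists (size p); apply/asboolP; exists p.
Qed.

Definition graph_dist (v w : G) : nat := ex_minn (walk_length_ex v w).

End distance.

Section function_spaces.
Variables (R : realType) (G : graph).
Implicit Types (f g : G -> R[i]) (v w : G).

Definition nbhd v : set G := [set w | adj v w].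

Definition edges : set (G * G) := [set e | adj e.1 e.2].

Definition edge_osc f : set R :=
  [set Normc.normc (f e.1 - f e.2) | e in edges].

Definition lip_seminorm f : R := sup (edge_osc f).

Definition lip_norm (a : G) f : R := Normc.normc (f a) + lip_seminorm f.

Definition lip_pred : {pred G -> R[i]} := mem [set f | has_ubound (edge_osc f)].

(* nbhd v is finite and nonempty, so this supremum is a maximum *)
Definition vertex_osc f v : R :=
  sup [set Normc.normc (f v - f w) | w in nbhd v].

Definition vanishing_osc (a : G) f : Prop :=
  forall e : R, 0 < e -> exists N : nat,
    forall v, (N < graph_dist a v)%N -> vertex_osc f v < e.

Definition lip0_pred (a : G) : {pred G -> R[i]} :=
  mem [set f | f \in lip_pred /\ vanishing_osc a f].

Lemma lip_predP f : reflect (exists M : R, forall v w, adj v w ->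
  Normc.normc (f v - f w) <= M) (f \in lip_pred).
Proof.
apply: (iffP idP) => [/set_mem[M fM]|[M fM]].
  by exists M => v w vw; apply: fM; exists (v, w).
by apply/mem_set; exists M => _ [[v w] /= vw <-]; apply: fM.
Qed.

Lemma nbhd_neq0 v : nbhd v !=set0.
Proof.
have [w wv] : exists w : G, w <> v.
  apply: contrapT => h; apply: (@vertex_infinite G).
  apply: (sub_finite_set _ (finite_set1 v)) => w _.
  by apply: contrapT => wv; apply: h; exists w.
have [[|u p] /= + pw] := adj_connected v w; first by case: wv.
by move=> /andP[vu _]; exists u.
Qed.

Lemma graph_edge : exists v w : G, adj v w.
Proof.
have [v _] := infinite_setN0 (@vertex_infinite G).
by have [w vw] := nbhd_neq0 v; exists v, w.
Qed.

Lemma edge_osc_neq0 f : edge_osc f !=set0.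
Proof. by have [v [w vw]] := graph_edge; eexists; exists (v, w). Qed.

Lemma le_lip_seminorm f v w : f \in lip_pred -> adj v w ->
  Normc.normc (f v - f w) <= lip_seminorm f.
Proof. by move=> /set_mem fL vw; apply: ub_le_sup => //; exists (v, w). Qed.

Lemma lip_seminorm_le f (M : R) :
  (forall v w, adj v w -> Normc.normc (f v - f w) <= M) -> lip_seminorm f <= M.
Proof.
move=> fM; apply: ge_sup; first exact: edge_osc_neq0.
by move=> _ [[v w] /= vw <-]; apply: fM.
Qed.

Lemma normc_ge0 (z : R[i]) : 0 <= Normc.normc z.
Proof. by case: z => x y; exact: sqrtr_ge0. Qed.

Lemma lip_seminorm_ge0 f : f \in lip_pred -> 0 <= lip_seminorm f.
Proof.
move=> fL; have [v [w vw]] := graph_edge.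
exact: le_trans (normc_ge0 _) (le_lip_seminorm fL vw).
Qed.

Lemma finite_set_max (A : set R) : finite_set A -> A !=set0 ->
  exists2 m, A m & ubound A m.
Proof.
move=> /finite_seqP[s ->] [x /= xs].
have {x xs} : s != [::] by case: (s) xs.
elim: s => // x [|y s] IHs _.
  by exists x => [|z /=]; rewrite /= inE // => /eqP ->.
have [//|m ms mub] := IHs; have [xm|mx] := leP x m.
  exists m => [|z /=]; rewrite /= in_cons; first by apply/orP; right.
  by move=> /predU1P[-> //|]; exact: mub.
exists x => [|z /=]; rewrite /= in_cons ?eqxx//.
by move=> /predU1P[-> //|/mub zm]; exact: le_trans zm (ltW mx).
Qed.

Lemma vertex_osc_lt f v (e : R) :
  vertex_osc f v < e <-> forall w, adj v w -> Normc.normc (f v - f w) < e.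
Proof.
set A := [set Normc.normc (f v - f w) | w in nbhd v].
have [||m [w vw <-] mub] := @finite_set_max A.
- by apply: finite_image; exact: adj_finite.
- by have [w vw] := nbhd_neq0 v; eexists; exists w.
split=> [fe u vu|fe].
  by apply: le_lt_trans fe; apply: ub_le_sup; [eexists; exact: mub|exists u].
by apply: le_lt_trans (fe w vw); apply: ge_sup => //; eexists; exists w.
Qed.

Lemma normc_diffD f g (k : R[i]) v w :
  Normc.normc ((k *: f + g) v - (k *: f + g) w) <=
  Normc.normc k * Normc.normc (f v - f w) + Normc.normc (g v - g w).
Proof.
rewrite -Normc.normcM; apply: le_trans (le_normcD _ _).
by rewrite mulrBr addrACA opprD lexx.
Qed.

Lemma lip_submod_closed : submod_closed lip_pred.
Proof.
split=> [|k f g /lip_predP[M fM] /lip_predP[N gN]]; apply/lip_predP.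
  by exists 0 => v w _; rewrite subrr Normc.normc0.
exists (Normc.normc k * M + N) => v w vw.
apply: le_trans (normc_diffD _ _ _ _ _) _.
by rewrite lerD ?gN// ler_wpM2l ?normc_ge0// fM.
Qed.

Lemma lip0_predP (a : G) f :
  reflect (f \in lip_pred /\ vanishing_osc a f) (f \in lip0_pred a).
Proof. by apply: (iffP idP) => [/set_mem|h]; [|apply/mem_set]. Qed.

Lemma lip0_submod_closed (a : G) : submod_closed (lip0_pred a).
Proof.
have [L0 Lkfg] := lip_submod_closed.
split=> [|k f g /lip0_predP[fL f0] /lip0_predP[gL g0]]; apply/lip0_predP.
  split=> // e e0; exists 0%N => v _; apply/vertex_osc_lt => w _.
  by rewrite subrr Normc.normc0.
split=> [|e e0]; first exact: Lkfg.
pose K := Normc.normc k + 1.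
have K0 : 0 < K by rewrite ltr_wpDl ?normc_ge0.
have [N fN] := f0 (e / 2 / K) (divr_gt0 (divr_gt0 e0 (ltr0Sn _ 1)) K0).
have [N' gN] := g0 (e / 2) (divr_gt0 e0 (ltr0Sn _ 1)).
exists (maxn N N') => v; rewrite gtn_max => /andP[vN vN'].
apply/vertex_osc_lt => w vw; apply: le_lt_trans (normc_diffD _ _ _ _ _) _.
have fw := (vertex_osc_lt _ _ _).1 (fN v vN) w vw.
have gw := (vertex_osc_lt _ _ _).1 (gN v vN') w vw.
rewrite [ltRHS]splitr; apply: ler_ltD gw.
rewrite ltr_pdivlMr// in fw; apply: le_trans (ltW fw).
by rewrite mulrC ler_wpM2l ?normc_ge0// lerDl.
Qed.

Lemma lip_normD (a : G) f g : f \in lip_pred -> g \in lip_pred ->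
  lip_norm a (f + g) <= lip_norm a f + lip_norm a g.
Proof.
move=> fL gL; rewrite /lip_norm addrACA lerD//; first exact: le_normcD.
apply: lip_seminorm_le => v w vw.
have := normc_diffD f g 1 v w; rewrite scale1r Normc.normc1 mul1r.
by move=> /le_trans; apply; rewrite lerD// le_lip_seminorm.
Qed.

Lemma lip_seminormZ (k : R[i]) f : f \in lip_pred ->
  lip_seminorm (k *: f) = Normc.normc k * lip_seminorm f.
Proof.
have [L0 Lkfg] := lip_submod_closed.
have le_Z h c : h \in lip_pred ->
    lip_seminorm (c *: h) <= Normc.normc c * lip_seminorm h.
  move=> hL; apply: lip_seminorm_le => v w vw.
  have := normc_diffD h 0 c v w.
  rewrite addr0 subrr Normc.normc0 addr0 => /le_trans; apply.
  by rewrite ler_wpM2l ?normc_ge0// le_lip_seminorm.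
move=> fL; apply/le_anti; rewrite le_Z//=.
have [->|k0] := eqVneq k 0.
  by rewrite Normc.normc0 mul0r scale0r lip_seminorm_ge0.
have kfL : k *: f \in lip_pred by rewrite -[_ *: _]addr0 Lkfg.
have nk0 : 0 < Normc.normc k.
  by rewrite lt_neqAle normc_ge0 andbT eq_sym; apply/eqP => /Normc.eq0_normc/eqP; apply/negP.
rewrite -ler_pdivlMl// -Normc.normcV.
by rewrite -[in leLHS](scalerK k0 f) le_Z.
Qed.

Lemma lip_normZ (a : G) (k : R[i]) f : f \in lip_pred ->
  lip_norm a (k *: f) = Normc.normc k * lip_norm a f.
Proof. by move=> fL; rewrite /lip_norm lip_seminormZ// mulrDr -Normc.normcM. Qed.

Lemma lip_norm_eq0 (a : G) f : f \in lip_pred -> lip_norm a f = 0 -> f = 0.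
Proof.
move=> fL /eqP; rewrite paddr_eq0 ?normc_ge0 ?lip_seminorm_ge0//.
move=> /andP[/eqP/Normc.eq0_normc fa0 /eqP f0].
apply/funext => v; have [p ap <-] := adj_connected a v.
elim: p a fa0 ap => //= u p IHp x fx0 /andP[xu up]; apply: IHp up.
have := le_lip_seminorm fL xu; rewrite f0 fx0 sub0r normcN => fu0.
by apply: Normc.eq0_normc; apply/le_anti; rewrite fu0 normc_ge0.
Qed.

End function_spaces.

Arguments lip_pred {R G}.

HB.instance Definition _ (R : realType) (G : graph) :=
  GRing.isSubmodClosed.Build R[i] (G -> R[i]) lip_pred
    (@lip_submod_closed R G).

HB.instance Definition _ (R : realType) (G : graph) (a : G) :=
  GRing.isSubmodClosed.Build R[i] (G -> R[i]) (lip0_pred a)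
    (@lip0_submod_closed R G a).

(* The base vertex a is a parameter of the type because the norm depends on it *)
Record lip (R : realType) (G : graph) (a : G) := Lip {
  lip_fun :> G -> R[i]; lip_funP : lip_fun \in lip_pred }.

Record lip0 (R : realType) (G : graph) (a : G) := Lip0 {
  lip0_fun :> G -> R[i]; lip0_funP : lip0_fun \in lip0_pred a }.

Section normed_modules.
Variables (R : realType) (G : graph) (a : G).

HB.instance Definition _ := [isSub for @lip_fun R G a].
HB.instance Definition _ := [Choice of lip R a by <:].
HB.instance Definition _ := [SubChoice_isSubLmodule of lip R a by <:].

HB.instance Definition _ := [isSub for @lip0_fun R G a].
HB.instance Definition _ := [Choice of lip0 R a by <:].
HB.instance Definition _ := [SubChoice_isSubLmodule of lip0 R a by <:].

Let norm_lip (f : lip R a) : R[i] := (lip_norm a f)%:C.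

Let norm_lipD f g : norm_lip (f + g) <= norm_lip f + norm_lip g.
Proof. by rewrite -rmorphD/= lecR lip_normD ?lip_funP. Qed.

Let norm_lipZ k f : norm_lip (k *: f) = `|k| * norm_lip f.
Proof. by rewrite /norm_lip lip_normZ ?lip_funP// rmorphM. Qed.

Let norm_lip_eq0 f : norm_lip f = 0 -> f = 0.
Proof.
by move=> /complexI f0; apply/val_inj/(lip_norm_eq0 (lip_funP f) f0).
Qed.

HB.instance Definition _ :=
  Lmodule_isNormed.Build R[i] (lip R a) norm_lipD norm_lipZ norm_lip_eq0.

Let norm_lip0 (f : lip0 R a) : R[i] := (lip_norm a f)%:C.

Let lip0_lip (f : lip0 R a) : (f : G -> R[i]) \in lip_pred.
Proof. by have /lip0_predP[] := lip0_funP f. Qed.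

Let norm_lip0D f g : norm_lip0 (f + g) <= norm_lip0 f + norm_lip0 g.
Proof. by rewrite -rmorphD/= lecR lip_normD ?lip0_lip. Qed.

Let norm_lip0Z k f : norm_lip0 (k *: f) = `|k| * norm_lip0 f.
Proof. by rewrite /norm_lip0 lip_normZ ?lip0_lip// rmorphM. Qed.

Let norm_lip0_eq0 f : norm_lip0 f = 0 -> f = 0.
Proof. by move=> /complexI f0; apply/val_inj/(lip_norm_eq0 (lip0_lip f) f0). Qed.

HB.instance Definition _ :=
  Lmodule_isNormed.Build R[i] (lip0 R a) norm_lip0D norm_lip0Z norm_lip0_eq0.

Lemma lip_normE (f : lip R a) : `|f| = (lip_norm a f)%:C.
Proof. by []. Qed.

Lemma lip0_normE (f : lip0 R a) : `|f| = (lip_norm a f)%:C.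
Proof. by []. Qed.

End normed_modules.

Section spectra.
Variables (K : numFieldType) (X : normedModType K).

Definition bounded_operator (T : {linear X -> X}) : Prop :=
  exists c : K, forall x, `|T x| <= c * `|x|.

Definition resolvent_set (T : {linear X -> X}) : set K :=
  [set l | exists S : {linear X -> X}, [/\ bounded_operator S,
    forall x, S (T x - l *: x) = x & forall x, T (S x) - l *: S x = x]].

Definition spectrum (T : {linear X -> X}) : set K := ~` resolvent_set T.

Definition point_spectrum (T : {linear X -> X}) : set K :=
  [set l | exists2 x, x != 0 & T x = l *: x].

Definition approximate_point_spectrum (T : {linear X -> X}) : set K :=
  [set l | exists2 u : nat -> X, forall n, `|u n| = 1 &
    (fun n => T (u n) - l *: u n) @ \oo --> (0 : X)].

End spectra.

(* A linear M : X -> X acting as multiplication by psi exists exactly when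
   psi f is in X for every f in X; it is then unique. *)
Definition lip_multiplication (R : realType) (G : graph) (a : G)
    (psi : G -> R[i]) (M : {linear lip R a -> lip R a}) : Prop :=
  forall (f : lip R a) (v : G), M f v = psi v * f v.

Definition lip0_multiplication (R : realType) (G : graph) (a : G)
    (psi : G -> R[i]) (M : {linear lip0 R a -> lip0 R a}) : Prop :=
  forall (f : lip0 R a) (v : G), M f v = psi v * f v.

(* Main.v *)
Require Import Defs.
From HB Require Import structures.
From mathcomp Require Import all_boot all_order all_algebra.
From mathcomp Require Import complex ring.
From mathcomp Require Import all_classical all_reals all_analysis.

Set Implicit Arguments.
Unset Strict Implicit.
Unset Printing Implicit Defensive.

Import Order.TTheory GRing.Theory Num.Theory.
Import numFieldNormedType.Exports.

Local Open Scope classical_set_scope.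
Local Open Scope ring_scope.
Local Open Scope complex_scope.

(** The indicator of a vertex [v] lies in both spaces and is an eigenvector
    of the multiplication operator for the eigenvalue [psi v]; conversely an
    eigenfunction for [l] is nonzero at some vertex, where [psi] must then
    take the value [l].  This settles the point spectrum.  Normalized
    indicators are approximate eigenvectors at every limit of values of [psi]
    ([closure_sub_approximate_point_spectrum]), and in any normed space the
    approximate point spectrum lies in the spectrum
    ([approximate_point_spectrum_sub]).

    There remains to invert [M - l] when [psi - l] is bounded away from 0 by
    some [c > 0].  The inverse has to be [f |-> f / (psi - l)], and the point
    is that it preserves the space and is bounded.  The values of [psi]
    are eigenvalues, so [psi] is bounded by the norm of [M], and along an edge
    from [v] to [w] the dangerous term [(psi v - psi w) * f v] is the
    difference of [psi * f] minus [psi w * (f v - f w)].  Hence the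
    oscillation of [f / (psi - l)] is at most a constant times that of
    [psi * f] plus a constant times that of [f] ([dist_divB_le]), and both of
    these functions belong to the space.  The argument uses only
    the indicators and the fact that functions of dominated oscillation stay
    in the space, so it is carried out once for both spaces
    ([lipschitz_multiplication_spectra]). *)

(** * Operators on normed spaces *)

(** The constant in [bounded_operator] is a scalar, hence possibly complex;
    its modulus serves as well. *)
Lemma bounded_operator_ge0 (K : numFieldType) (X : normedModType K)
    (T : {linear X -> X}) : bounded_operator T ->
  exists2 c, 0 <= c & forall x, `|T x| <= c * `|x|.
Proof.
move=> [c Tc]; exists `|c| => // x.
have c0 : 0 <= c * `|x| := le_trans (normr_ge0 _) (Tc x).
by rewrite -[`|x|]normr_id -normrM ger0_norm.
Qed.

(** A bounded inverse of [T - l] would send [T (u n) - l *: u n], which tends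
    to 0, back to the unit vectors [u n]. *)
Lemma approximate_point_spectrum_sub (K : numFieldType) (X : normedModType K)
    (T : {linear X -> X}) : approximate_point_spectrum T `<=` spectrum T.
Proof.
move=> l [u u1 Tu] [S [/bounded_operator_ge0[c c0 Sc] ST _]].
have c1 : 0 < c + 1 by rewrite ltr_wpDl.
have [n _ /(_ n (leqnn n))/= Tun] :
    \forall n \near \oo, `|T (u n) - l *: u n| < (c + 1)^-1.
  by move: Tu => /cvgr0Pnorm_lt; apply; rewrite invr_gt0.
have := Sc (T (u n) - l *: u n); rewrite ST u1 => le1.
suff /(le_lt_trans le1) : c * `|T (u n) - l *: u n| < 1 by rewrite ltxx.
apply: (@le_lt_trans _ _ ((c + 1) * `|T (u n) - l *: u n|)).
  by rewrite ler_wpM2r// lerDl.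
by rewrite mulrC -ltr_pdivlMr// mul1r.
Qed.

(** * Multiplication operators on an abstract function space *)

(** The normed space X is seen as a space of functions on G through the
    injective linear map [ev]. *)
Section multiplication_operator.
Variables (K : numFieldType) (X : normedModType K) (G : choiceType).
Variables (ev : X -> G -> K) (psi : G -> K) (M : {linear X -> X}).
Hypothesis evP : forall k x y v, ev (k *: x + y) v = k * ev x v + ev y v.
Hypothesis ev_inj : injective ev.
Hypothesis ev_indic : forall v, exists x, forall w, ev x w = (w == v)%:R.
Hypothesis evM : forall x v, ev (M x) v = psi v * ev x v.

Let ev0 v : ev 0 v = 0.
Proof.
by have := evP (-1) 0 0 v; rewrite scaleN1r addNr mulN1r addNr.
Qed.

Let evZ k x v : ev (k *: x) v = k * ev x v.
Proof. by have := evP k x 0 v; rewrite !addr0 ev0 addr0. Qed.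

(** The eigenvector is the indicator of [v]. *)
Lemma eigenvector_at v : exists2 x, x != 0 & M x = psi v *: x.
Proof.
have [x xv] := ev_indic v; exists x.
  apply: contra_eq_neq (xv v) => ->.
  by rewrite ev0 eqxx eq_sym oner_eq0.
apply: ev_inj; apply/funext => w; rewrite evM evZ xv.
by have [->//|_] := eqVneq w v; rewrite !mulr0.
Qed.

Lemma multiplication_point_spectrum : point_spectrum M = range psi.
Proof.
apply/seteqP; split=> [l [x x0 Mx]|_ [v _ <-]]; last exact: eigenvector_at.
have [v xv] : exists v, ev x v != 0.
  apply: contrapT => /forallNP h; move/eqP: x0; apply; apply: ev_inj.
  by apply/funext => v; rewrite ev0; apply/eqP/negbNE/negP/h.
exists v => //; apply: (mulIf xv).
by rewrite -evM Mx evZ.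
Qed.

(** Every value of [psi] is an eigenvalue, and no eigenvalue exceeds the
    operator norm. *)
Lemma multiplication_symbol_bounded (c : K) :
  (forall x, `|M x| <= c * `|x|) -> forall v, `|psi v| <= c.
Proof.
move=> Mc v; have [x x0 Mx] := eigenvector_at v.
by have := Mc x; rewrite Mx normrZ ler_pM2r// normr_gt0.
Qed.

(* Division by psi - l is bounded on X once psi stays away from l. *)
Hypothesis ev_div : forall (l c : K), 0 < c ->
  (forall v, c <= `|psi v - l|) -> exists C, forall x, exists y,
    (forall v, ev y v = (psi v - l)^-1 * ev x v) /\ `|y| <= C * `|x|.

(** Off the closure, [psi - l] is bounded away from 0, so division by
    [psi - l] is the resolvent. *)
Lemma multiplication_spectrum_sub : spectrum M `<=` closure (range psi).
Proof.
move=> l; apply: contra_notP => lpsi.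
have [e e0 eP] : exists2 e : K, 0 < e & forall v, e <= `|psi v - l|.
  apply: contrapT => h; apply: lpsi => B /nbhs_ballP[e /= e0 eB].
  apply: contrapT => h'; apply: h; exists e => // v.
  rewrite real_leNgt ?normr_real ?(gtr0_real e0)//; apply/negP => ve.
  apply: h'; exists (psi v); split; first by exists v.
  by apply: eB; rewrite -ball_normE /= distrC.
have pl0 v : psi v - l != 0 by rewrite -normr_gt0 (lt_le_trans e0).
have [C /choice[S SP]] := ev_div e0 eP.
have Slin : linear S.
  move=> k x y; apply: ev_inj; apply/funext => v.
  by rewrite evP !(SP _).1 evP mulrDr mulrCA.
pose S' : {linear X -> X} := HB.pack S (GRing.isLinear.Build _ _ _ _ S Slin).
have evMl x v : ev (M x - l *: x) v = (psi v - l) * ev x v.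
  by rewrite addrC -scaleNr evP evM mulNr addrC -mulrBl.
exists S'; split.
- by exists C => x; exact: (SP x).2.
- move=> x; apply: ev_inj; apply/funext => v.
  by rewrite (SP _).1 evMl mulKf.
- move=> x; apply: ev_inj; apply/funext => v.
  by rewrite evMl (SP _).1 mulVKf.
Qed.

End multiplication_operator.
Arguments multiplication_symbol_bounded {K X G ev psi M}.

Section complex_multiplication_operator.
Variables (R : realType) (X : normedModType R[i]) (G : choiceType).
Variables (ev : X -> G -> R[i]) (psi : G -> R[i]) (M : {linear X -> X}).
Hypothesis evP : forall k x y v, ev (k *: x + y) v = k * ev x v + ev y v.
Hypothesis ev_inj : injective ev.
Hypothesis ev_indic : forall v, exists x, forall w, ev x w = (w == v)%:R.
Hypothesis evM : forall x v, ev (M x) v = psi v * ev x v.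

(** Normalized eigenvectors at vertices where [psi] comes within [1 / n.+1]
    of [l] are approximate eigenvectors for [l].  The scalars are the complex
    numbers here because the sequence [1 / n.+1] has to tend to 0. *)
Lemma closure_sub_approximate_point_spectrum :
  closure (range psi) `<=` approximate_point_spectrum M.
Proof.
move=> l lpsi.
have /choice[s sP] (n : nat) : exists v, `|psi v - l| < (n.+1%:R^-1 : R)%:C.
  have n0 : 0 < (n.+1%:R^-1 : R)%:C by rewrite ltcR invr_gt0.
  have [_ [[v _ <-]]] := lpsi _ (nbhsx_ballx l _ n0).
  by rewrite -ball_normE /= distrC => ?; exists v.
have /choice[x xP] (n : nat) : exists x, `|x| = 1 /\ M x = psi (s n) *: x.
  have [y y0 My] := eigenvector_at evP ev_inj ev_indic evM (s n).
  exists (`|y|^-1 *: y); rewrite normrZ normfV normr_id mulVf ?normr_eq0//.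
  by split=> //; rewrite linearZ My scalerA mulrC -scalerA.
exists x => [n|]; first exact: (xP n).1.
apply/cvgr0Pnorm_lt => e; rewrite ltcE => /andP[/= /eqP e_im e_re].
have [N _ NP] := near_infty_natSinv_lt (PosNum e_re).
exists N => // n /NP /= ne.
rewrite (xP n).2 -scalerBl normrZ (xP n).1 mulr1.
apply: lt_trans (sP n) _.
by rewrite ltcE /= -e_im eqxx.
Qed.

Hypothesis bM : bounded_operator M.
Hypothesis ev_div : forall (l c : R[i]), 0 < c ->
  (forall v, c <= `|psi v - l|) -> exists C, forall x, exists y,
    (forall v, ev y v = (psi v - l)^-1 * ev x v) /\ `|y| <= C * `|x|.

Lemma multiplication_spectra :
  point_spectrum M = range psi /\
  (spectrum M = approximate_point_spectrum M /\
   approximate_point_spectrum M = closure (range psi)).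
Proof.
have ap_sp := @approximate_point_spectrum_sub _ _ M.
have sp_cl := multiplication_spectrum_sub evP ev_inj evM ev_div.
have cl_ap := closure_sub_approximate_point_spectrum.
split; first exact: multiplication_point_spectrum evP ev_inj ev_indic evM.
split; apply/seteqP; split=> //.
  exact: subset_trans sp_cl cl_ap.
exact: subset_trans ap_sp sp_cl.
Qed.

End complex_multiplication_operator.

(** * The oscillation of a quotient *)

(** The difference of quotients is [(q - l)^-1 * (x - y)] minus
    [(p - l)^-1 * (q - l)^-1 * ((p - q) * x)], and the factor [(p - q) * x],
    the only one not bounded by [`|x - y|] since [x] itself may be large,
    equals [(p * x - q * y) - q * (x - y)].  For [x = f v], [y = f w],
    [p = psi v] and [q = psi w] this trades the size of [f] for the
    oscillation of [psi * f]. *)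
Lemma dist_divB_le (K : numFieldType) (p q l x y c B : K) :
  0 < c -> c <= `|p - l| -> c <= `|q - l| -> `|q| <= B ->
  `|(p - l)^-1 * x - (q - l)^-1 * y| <=
  c ^- 2 * `|p * x - q * y| + (c ^- 2 * B + c^-1) * `|x - y|.
Proof.
move=> c0 cp cq qB.
have pl0 : p - l != 0 by rewrite -normr_gt0 (lt_le_trans c0).
have ql0 : q - l != 0 by rewrite -normr_gt0 (lt_le_trans c0).
have -> : (p - l)^-1 * x - (q - l)^-1 * y =
    (q - l)^-1 * (x - y)
    - (p - l)^-1 * (q - l)^-1 * (p * x - q * y - q * (x - y)).
  by field; rewrite pl0 ql0.
have V z : c <= `|z| -> `|z^-1| <= c^-1.
  move=> cz; rewrite normfV lef_pV2 ?posrE//; exact: lt_le_trans cz.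
have V2 : `|(p - l)^-1 * (q - l)^-1| <= c ^- 2.
  by rewrite normrM -exprVn expr2 ler_pM// V.
have -> : c ^- 2 * `|p * x - q * y| + (c ^- 2 * B + c^-1) * `|x - y| =
    c^-1 * `|x - y| + c ^- 2 * (`|p * x - q * y| + B * `|x - y|) by ring.
apply: le_trans (ler_normB _ _) _; apply: lerD.
  by rewrite normrM ler_wpM2r// V.
rewrite normrM ler_pM//.
apply: le_trans (ler_normB _ _) _; rewrite lerD2l normrM.
by rewrite ler_wpM2r.
Qed.

Lemma normc_divB_le (R : realType) (p q l x y : R[i]) (c B : R) :
  0 < c -> c <= Normc.normc (p - l) -> c <= Normc.normc (q - l) ->
  Normc.normc q <= B ->
  Normc.normc ((p - l)^-1 * x - (q - l)^-1 * y) <=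
  c ^- 2 * Normc.normc (p * x - q * y)
  + (c ^- 2 * B + c^-1) * Normc.normc (x - y).
Proof.
rewrite -ltcR -!lecR => c0 cp cq qB.
have := dist_divB_le x y c0 cp cq qB.
by rewrite !(rmorphD, rmorphM, rmorphXn, fmorphV).
Qed.

(** * Functions of dominated oscillation *)

Section dominated_oscillation.
Variables (R : realType) (G : graph) (a : G) (f h g : G -> R[i]) (A B : R).
Hypotheses (A0 : 0 <= A) (B0 : 0 <= B).
Hypothesis gle : forall v w, adj v w -> Normc.normc (g v - g w) <=
  A * Normc.normc (h v - h w) + B * Normc.normc (f v - f w).

Lemma dominated_osc_le v w : f \in lip_pred -> h \in lip_pred -> adj v w ->
  Normc.normc (g v - g w) <= A * lip_seminorm h + B * lip_seminorm f.
Proof.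
move=> fL hL vw; apply: le_trans (gle vw) _.
by rewrite lerD// ler_wpM2l// le_lip_seminorm.
Qed.

Lemma dominated_lip : f \in lip_pred -> h \in lip_pred -> g \in lip_pred.
Proof.
move=> fL hL; apply/lip_predP; eexists => v w; exact: dominated_osc_le.
Qed.

Lemma dominated_vanishing :
  vanishing_osc a f -> vanishing_osc a h -> vanishing_osc a g.
Proof.
move=> f0 h0 e e0.
have D0 : 0 < A + B + 1 by rewrite ltr_wpDl ?addr_ge0.
have [N fN] := f0 _ (divr_gt0 e0 D0).
have [N' hN] := h0 _ (divr_gt0 e0 D0).
exists (maxn N N') => v; rewrite gtn_max => /andP[vN vN'].
apply/vertex_osc_lt => w vw; apply: le_lt_trans (gle vw) _.
have /ltW fw := (vertex_osc_lt _ _ _).1 (fN v vN) w vw.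
have /ltW hw := (vertex_osc_lt _ _ _).1 (hN v vN') w vw.
apply: (@le_lt_trans _ _ ((A + B) * (e / (A + B + 1)))).
  by rewrite mulrDl lerD// ler_wpM2l.
by rewrite mulrCA gtr_pMr// ltr_pdivrMr// mul1r ltrDl.
Qed.

Lemma dominated_lip0 :
  f \in lip0_pred a -> h \in lip0_pred a -> g \in lip0_pred a.
Proof.
move=> /lip0_predP[fL f0] /lip0_predP[hL h0]; apply/lip0_predP.
by split; [exact: dominated_lip | exact: dominated_vanishing].
Qed.

End dominated_oscillation.

(** * Indicators of vertices *)

Section indicator.
Variables (R : realType) (G : graph) (a : G).

Definition indicator_at (v w : G) : R[i] := (w == v)%:R.

Lemma indicator_lip v : indicator_at v \in lip_pred.
Proof.
apply/lip_predP; exists (1 + 1) => u w _; apply: le_trans (le_normcD _ _) _.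
rewrite normcN /indicator_at.
by apply: lerD; case: eqP => _; rewrite ?Normc.normc1 ?Normc.normc0.
Qed.

Lemma graph_dist_adj (u w : G) : adj u w ->
  (graph_dist a w <= (graph_dist a u).+1)%N.
Proof.
move=> uw; rewrite /graph_dist.
case: ex_minnP => m _ mmin; case: ex_minnP => n /asboolP[p [ap pu <-]] _.
apply: mmin; apply/asboolP; exists (rcons p w).
by rewrite rcons_path ap pu last_rcons size_rcons.
Qed.

(** The oscillation at [u] vanishes once [u] is neither [v] nor adjacent to
    [v], in particular beyond distance [(graph_dist a v).+1] from [a]. *)
Lemma indicator_lip0 v : indicator_at v \in lip0_pred a.
Proof.
apply/lip0_predP; split=> [|e e0]; first exact: indicator_lip.
exists (graph_dist a v).+1 => u vu; apply/vertex_osc_lt => w uw.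
rewrite /indicator_at; case: (eqVneq u v) vu uw => [->|_ vu uw].
  by rewrite ltnNge leqnSn.
case: (eqVneq w v) vu uw => [->|_ _ _]; last by rewrite subrr Normc.normc0.
rewrite adj_sym => vu /graph_dist_adj.
by rewrite leqNgt vu.
Qed.

End indicator.

Lemma ge0_complex_real (R : realType) (c : R[i]) : 0 <= c ->
  exists2 r : R, 0 <= r & c = r%:C.
Proof.
case: c => x y; rewrite lecE /= => /andP[/eqP -> x0].
by exists x.
Qed.

(** * Spaces of Lipschitz functions *)

(** The space X stands for either of the two Lipschitz spaces.  Besides
    containing the indicators of vertices, they share one closure property,
    [ev_dom]: a function belongs to X as soon as its oscillation along edges
    is dominated by those of two members of X. *)
Section lipschitz_space.
Variables (R : realType) (G : graph) (a : G) (X : normedModType R[i]).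
Variables (ev : X -> G -> R[i]) (psi : G -> R[i]) (M : {linear X -> X}).
Hypothesis evP : forall k x y v, ev (k *: x + y) v = k * ev x v + ev y v.
Hypothesis ev_inj : injective ev.
Hypothesis ev_indic : forall v, exists x, ev x = indicator_at R v.
Hypothesis ev_lip : forall x, ev x \in lip_pred.
Hypothesis ev_norm : forall x, `|x| = (lip_norm a (ev x))%:C.
Hypothesis ev_dom : forall x y g (A B : R), 0 <= A -> 0 <= B ->
  (forall v w, adj v w -> Normc.normc (g v - g w) <=
    A * Normc.normc (ev y v - ev y w) + B * Normc.normc (ev x v - ev x w)) ->
  exists z, ev z = g.
Hypothesis evM : forall x v, ev (M x) v = psi v * ev x v.
Hypothesis bM : bounded_operator M.

Let ev_indicator v : exists x, forall w, ev x w = (w == v)%:R.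
Proof. by have [x xv] := ev_indic v; exists x => w; rewrite xv. Qed.

(** By [normc_divB_le], the oscillation of [(psi - l)^-1 * f] is dominated by
    those of [psi * f] and [f].  This puts the quotient in the space and
    bounds its norm by those of [psi * f] and [f], and the boundedness of the
    multiplication operator takes care of [psi * f]. *)
Lemma division_bounded (l d : R[i]) : 0 < d ->
  (forall v, d <= `|psi v - l|) -> exists C, forall x, exists y,
    (forall v, ev y v = (psi v - l)^-1 * ev x v) /\ `|y| <= C * `|x|.
Proof.
move=> d0; have [c _ dE] := ge0_complex_real (ltW d0).
rewrite {}dE ltcR in d0 * => cpsi.
have [_ /ge0_complex_real[B B0 ->] MB] := bounded_operator_ge0 bM.
have psiB := multiplication_symbol_bounded evP ev_inj ev_indicator evM _ MB.
have {}cpsi v : c <= Normc.normc (psi v - l) by rewrite -lecR; exact: cpsi.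
have {}psiB v : Normc.normc (psi v) <= B by rewrite -lecR; exact: psiB.
have A0 : 0 <= c ^- 2 by rewrite invr_ge0 exprn_ge0// ltW.
have cV0 : 0 <= c^-1 by rewrite invr_ge0 ltW.
have D0 : 0 <= c ^- 2 * B + c^-1 by rewrite addr_ge0 ?mulr_ge0.
exists (c ^- 2 * B + (c ^- 2 * B + c^-1))%:C => x.
pose g v := (psi v - l)^-1 * ev x v.
have gle v w : Normc.normc (g v - g w) <=
    c ^- 2 * Normc.normc (ev (M x) v - ev (M x) w)
    + (c ^- 2 * B + c^-1) * Normc.normc (ev x v - ev x w).
  by rewrite !evM; exact: normc_divB_le.
have [y yg] := ev_dom A0 D0 (fun v w _ => gle v w).
exists y; split=> [v|]; first by rewrite yg.
have Mx : lip_norm a (ev (M x)) <= B * lip_norm a (ev x).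
  by have := MB x; rewrite !ev_norm -rmorphM lecR.
rewrite !ev_norm -rmorphM lecR yg mulrDl -mulrA.
apply: le_trans (lerD (ler_wpM2l A0 Mx) (lexx _)).
have sle : lip_seminorm g <= c ^- 2 * lip_seminorm (ev (M x))
    + (c ^- 2 * B + c^-1) * lip_seminorm (ev x).
  apply: lip_seminorm_le => v w.
  by apply: (dominated_osc_le A0 D0) => // u u' _; exact: gle.
rewrite /lip_norm !mulrDr addrACA lerD//.
rewrite Normc.normcM Normc.normcV; apply: ler_wpDl.
  by rewrite mulr_ge0// normc_ge0.
rewrite ler_wpM2r ?normc_ge0//; apply: ler_wpDl; first by rewrite mulr_ge0.
by rewrite lef_pV2 ?posrE// (lt_le_trans d0).
Qed.

Lemma lipschitz_multiplication_spectra :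
  point_spectrum M = range psi /\
  (spectrum M = approximate_point_spectrum M /\
   approximate_point_spectrum M = closure (range psi)).
Proof.
exact: multiplication_spectra evP ev_inj ev_indicator evM division_bounded.
Qed.

End lipschitz_space.

Theorem theorem6p1 (R : realType) (G : graph) (a : G) (psi : G -> R[i]) :
  (forall M : {linear lip R a -> lip R a},
     lip_multiplication psi M -> bounded_operator M ->
     point_spectrum M = range psi /\
     (spectrum M = approximate_point_spectrum M /\
      approximate_point_spectrum M = closure (range psi))) /\
  (forall M : {linear lip0 R a -> lip0 R a},
     lip0_multiplication psi M -> bounded_operator M ->
     point_spectrum M = range psi /\
     (spectrum M = approximate_point_spectrum M /\
      approximate_point_spectrum M = closure (range psi))).
Proof.
split=> M MP bM.
- apply: (@lipschitz_multiplication_spectra R G a _ (@lip_fun R G a)) MP bM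
    => //.
  + exact: val_inj.
  + by move=> v; exists (Lip a (indicator_lip R v)).
  + exact: lip_funP.
  + move=> x y g A B A0 B0 gle.
    by exists (Lip a (dominated_lip A0 B0 gle (lip_funP x) (lip_funP y))).
- apply: (@lipschitz_multiplication_spectra R G a _ (@lip0_fun R G a)) MP bM
    => //.
  + exact: val_inj.
  + by move=> v; exists (Lip0 (indicator_lip0 R a v)).
  + by move=> x; have /lip0_predP[] := lip0_funP x.
  + move=> x y g A B A0 B0 gle.
    by exists (Lip0 (dominated_lip0 A0 B0 gle (lip0_funP x) (lip0_funP y))).
Qed.
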